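(* (Weak coassociativity.) Let $(V,\mathcal{Y},c)$ be a graded vertex coalgebra and let $v'\in(V^{\otimes3})'$. There exists $k\in\mathbb{Z}_+$ such that $$(x_0+x_2)^k\left\langle v',\,(\mathcal{Y}(x_0)\otimes Id_V)\mathcal{Y}(x_2)v-(Id_V\otimes\mathcal{Y}(x_2))\mathcal{Y}(x_0+x_2)v\right\rangle=0$$ for any $v\in V$.
   Context: All vector spaces are over a field $\mathbb{F}$ of characteristic $0$; $x,x_0,x_1,x_2$ are commuting formal variables; $\mathbb{Z}_+$ is the set of positive integers. $\delta(x)=\sum_{n\in\mathbb{Z}}x^n$. For $n\in\mathbb{Z}$, $(x_i\pm x_j)^n$ is expanded in nonnegative integral powers of the second listed variable $x_j$ (this also applies inside $\delta$ and to $\mathcal{Y}(x_0+x_2)$). $W[[x,x^{-1}]]$ is the space of all doubly infinite formal series with coefficients in $W$, and $W((x^{-1}))$ is the space of those with only finitely many positive powers of $x$. $T(u\otimes v)=v\otimes u$ on $V\otimes V$. Linear maps and pairings act on formal series coefficientwise. A vertex coalgebra $(V,\mathcal{Y},c)$ is a vector space $V$ with linear maps $\mathcal{Y}(x):V\to(V\otimes V)[[x,x^{-1}]]$ and $c:V\to\mathbb{F}$ such that for all $v\in V$: 1. Left counit: $(c\otimes Id_V)\mathcal{Y}(x)v=v$. 2. Cocreation: $(Id_V\otimes c)\mathcal{Y}(x)v\in V[[x]]$ and $\lim_{x\to0}(Id_V\otimes c)\mathcal{Y}(x)v=v$. 3. Truncation: $\mathcal{Y}(x)v\in(V\otimes V)((x^{-1}))$.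 4. Jacobi identity: $$x_0^{-1}\delta\left(\tfrac{x_1-x_2}{x_0}\right)(Id_V\otimes\mathcal{Y}(x_2))\mathcal{Y}(x_1)-x_0^{-1}\delta\left(\tfrac{x_2-x_1}{-x_0}\right)(T\otimes Id_V)(Id_V\otimes\mathcal{Y}(x_1))\mathcal{Y}(x_2)=x_2^{-1}\delta\left(\tfrac{x_1-x_0}{x_2}\right)(\mathcal{Y}(x_0)\otimes Id_V)\mathcal{Y}(x_2).$$ It is a graded vertex coalgebra if $V=\coprod_{k\in\mathbb{Z}}V_{(k)}$ is $\mathbb{Z}$-graded with $V_{(k)}=0$ for $k$ sufficiently negative and, writing $\mathcal{Y}(x)v=\sum_{k\in\mathbb{Z}}\Delta_k(v)x^{-k-1}$, one has $\Delta_k(v)\in(V\otimes V)_{(r+k+1)}$ for all $v\in V_{(r)}$ and $r,k\in\mathbb{Z}$. For a graded space $W=\coprod_k W_{(k)}$, the graded dual is $W'=\coprod_k \mathrm{Hom}(W_{(k)},\mathbb{F})$, and $\langle\cdot,\cdot\rangle$ is the natural pairing of $W'$ with $W$. $V^{\otimes n}$ is graded by total weight, and $(V^{\otimes n})'$ is its graded dual. *)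

(* Defs.v *)
From HB Require Import structures.
From mathcomp Require Import all_boot all_order all_algebra.
From mathcomp Require Import generic_quotient sesquilinear finmap.
From mathcomp Require Import boolp classical_sets functions cardinality fsbigop.

Set Implicit Arguments.
Unset Strict Implicit.
Unset Printing Implicit Defensive.

Import GRing.Theory.
Local Open Scope quotient_scope.
Local Open Scope ring_scope.
Local Open Scope classical_set_scope.

(* A list [:: (v_1, w_1); ...; (v_n, w_n)] stands for the formal sum of the
   v_i (x) w_i; scalars are absorbed in the v_i. Two formal sums are identified
   when no bilinear map, into any vector space, distinguishes them. The
   universal property is given by tliftE and tensor_lin_ext below. *)
Definition fsum_eval (F : fieldType) (V W X : lmodType F) (f : V -> W -> X)
  (s : seq (V * W)) : X := \sum_(p <- s) f p.1 p.2.

Definition fsum_eq (F : fieldType) (V W : lmodType F) : rel (seq (V * W)) :=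
  fun s t => `[< forall (X : lmodType F) (f : {bilinear V -> W -> X}),
                   fsum_eval f s = fsum_eval f t >].

Lemma fsum_eq_refl (F : fieldType) (V W : lmodType F) :
  reflexive (@fsum_eq F V W).
Proof. by move=> s; apply/asboolP. Qed.

Lemma fsum_eq_sym (F : fieldType) (V W : lmodType F) :
  symmetric (@fsum_eq F V W).
Proof. by move=> s t; apply/asboolP/asboolP => h X f; rewrite h. Qed.

Lemma fsum_eq_trans (F : fieldType) (V W : lmodType F) :
  transitive (@fsum_eq F V W).
Proof.
by move=> t s u /asboolP h /asboolP k; apply/asboolP => X f; rewrite h k.
Qed.

Canonical fsum_equiv (F : fieldType) (V W : lmodType F) :=
  EquivRel (@fsum_eq F V W) (@fsum_eq_refl F V W) (@fsum_eq_sym F V W)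
    (@fsum_eq_trans F V W).

Definition tensor (F : fieldType) (V W : lmodType F) : Type :=
  {eq_quot (@fsum_equiv F V W)}.

HB.instance Definition _ (F : fieldType) (V W : lmodType F) :=
  Choice.copy (tensor V W) {eq_quot (@fsum_equiv F V W)}.
HB.instance Definition _ (F : fieldType) (V W : lmodType F) :=
  EqQuotient.copy (tensor V W) {eq_quot (@fsum_equiv F V W)}.

Definition tclass (F : fieldType) (V W : lmodType F) (s : seq (V * W)) :
  tensor V W := \pi_(tensor V W) s.

Lemma tclassP (F : fieldType) (V W : lmodType F) (s t : seq (V * W)) :
  tclass s = tclass t <->
  forall (X : lmodType F) (f : {bilinear V -> W -> X}),
    fsum_eval f s = fsum_eval f t.
Proof.
split=> [/eqmodP /asboolP //|h].
by apply/eqmodP/asboolP.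
Qed.

Lemma tclassK (F : fieldType) (V W : lmodType F) (t : tensor V W) :
  tclass (repr t) = t.
Proof. exact: reprK. Qed.

Definition tens (F : fieldType) (V W : lmodType F) (v : V) (w : W) :
  tensor V W := tclass [:: (v, w)].

Definition tlift (F : fieldType) (V W X : lmodType F) (f : V -> W -> X)
  (t : tensor V W) : X := fsum_eval f (repr t).

Lemma tlift_class (F : fieldType) (V W X : lmodType F)
    (f : {bilinear V -> W -> X}) (s : seq (V * W)) :
  tlift f (tclass s) = fsum_eval f s.
Proof. by have /tclassP := tclassK (tclass s); apply. Qed.

Definition tadd (F : fieldType) (V W : lmodType F) (t u : tensor V W) :=
  tclass (repr t ++ repr u).
Definition tscale (F : fieldType) (V W : lmodType F) (a : F) (t : tensor V W) :=
  tclass [seq (a *: p.1, p.2) | p <- repr t].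
Definition topp (F : fieldType) (V W : lmodType F) (t : tensor V W) :=
  tscale (-1) t.
Definition tzero (F : fieldType) (V W : lmodType F) : tensor V W := tclass [::].

Lemma tensorP (F : fieldType) (V W : lmodType F) (t u : tensor V W) :
  (forall (X : lmodType F) (f : {bilinear V -> W -> X}), tlift f t = tlift f u)
  -> t = u.
Proof. by move=> h; rewrite -(tclassK t) -(tclassK u); apply/tclassP. Qed.

Lemma tliftD (F : fieldType) (V W X : lmodType F) (f : {bilinear V -> W -> X})
    (t u : tensor V W) :
  tlift f (tadd t u) = tlift f t + tlift f u.
Proof. by rewrite tlift_class /fsum_eval big_cat. Qed.

Lemma tliftZ (F : fieldType) (V W X : lmodType F) (f : {bilinear V -> W -> X})
    (a : F) (t : tensor V W) :
  tlift f (tscale a t) = a *: tlift f t.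
Proof.
rewrite tlift_class /fsum_eval big_map scaler_sumr.
by apply: eq_bigr => p _; rewrite linearZl_LR.
Qed.

Lemma tlift0 (F : fieldType) (V W X : lmodType F) (f : {bilinear V -> W -> X}) :
  tlift f (tzero V W) = 0.
Proof. by rewrite tlift_class /fsum_eval big_nil. Qed.

Lemma taddA (F : fieldType) (V W : lmodType F) : associative (@tadd F V W).
Proof. by move=> t u v; apply: tensorP => X f; rewrite !tliftD addrA. Qed.
Lemma taddC (F : fieldType) (V W : lmodType F) : commutative (@tadd F V W).
Proof. by move=> t u; apply: tensorP => X f; rewrite !tliftD addrC. Qed.
Lemma tadd0 (F : fieldType) (V W : lmodType F) :
  left_id (tzero V W) (@tadd F V W).
Proof. by move=> t; apply: tensorP => X f; rewrite tliftD tlift0 add0r. Qed.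
Lemma taddN (F : fieldType) (V W : lmodType F) :
  left_inverse (tzero V W) (@topp F V W) (@tadd F V W).
Proof.
move=> t; apply: tensorP => X f.
by rewrite tliftD tlift0 tliftZ scaleN1r addNr.
Qed.

HB.instance Definition _ (F : fieldType) (V W : lmodType F) :=
  GRing.isZmodule.Build (tensor V W)
    (@taddA F V W) (@taddC F V W) (@tadd0 F V W) (@taddN F V W).

Lemma tscaleA (F : fieldType) (V W : lmodType F) (a b : F) (t : tensor V W) :
  tscale a (tscale b t) = tscale (a * b) t.
Proof. by apply: tensorP => X f; rewrite !tliftZ scalerA. Qed.
Lemma tscale1 (F : fieldType) (V W : lmodType F) :
  left_id (1 : F) (@tscale F V W).
Proof. by move=> t; apply: tensorP => X f; rewrite tliftZ scale1r. Qed.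
Lemma tscaleDr (F : fieldType) (V W : lmodType F) :
  right_distributive (@tscale F V W) +%R.
Proof.
by move=> a t u; apply: tensorP => X f; rewrite !(tliftD, tliftZ) scalerDr.
Qed.
Lemma tscaleDl (F : fieldType) (V W : lmodType F) (t : tensor V W) :
  {morph (@tscale F V W)^~ t : a b / a + b}.
Proof.
by move=> a b; apply: tensorP => X f; rewrite !(tliftD, tliftZ) scalerDl.
Qed.

HB.instance Definition _ (F : fieldType) (V W : lmodType F) :=
  GRing.Zmodule_isLmodule.Build F (tensor V W)
    (@tscaleA F V W) (@tscale1 F V W) (@tscaleDr F V W) (@tscaleDl F V W).

Lemma tlift_is_linear (F : fieldType) (V W X : lmodType F)
    (f : {bilinear V -> W -> X}) : linear (tlift f).
Proof. by move=> a t u; rewrite [LHS]tliftD tliftZ. Qed.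

HB.instance Definition _ (F : fieldType) (V W X : lmodType F)
    (f : {bilinear V -> W -> X}) :=
  GRing.isLinear.Build F (tensor V W) X *:%R (tlift f) (tlift_is_linear f).

Lemma tliftE (F : fieldType) (V W X : lmodType F) (f : {bilinear V -> W -> X})
    (v : V) (w : W) : tlift f (tens v w) = f v w.
Proof. by rewrite tlift_class /fsum_eval big_seq1. Qed.

Lemma tens_is_bilinear (F : fieldType) (V W : lmodType F) :
  bilinear_for *:%R *:%R (@tens F V W).
Proof.
by split=> [w|v] a x y /=; apply: tensorP => X f;
  rewrite linearP /= !tliftE ?linearPl ?linearPr.
Qed.

HB.instance Definition _ (F : fieldType) (V W : lmodType F) :=
  bilinear_isBilinear.Build F V W (tensor V W) *:%R *:%R (@tens F V W)
    (@tens_is_bilinear F V W).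

Lemma tensor_sum (F : fieldType) (V W : lmodType F) (t : tensor V W) :
  exists s : seq (V * W), t = \sum_(p <- s) tens p.1 p.2.
Proof.
exists (repr t); apply: tensorP => X f; rewrite linear_sum /=.
by apply: eq_bigr => p _; rewrite tliftE.
Qed.

Lemma tlift_sum (F : fieldType) (V W X : lmodType F)
    (f : {bilinear V -> W -> X}) (s : seq (V * W)) :
  tlift f (\sum_(p <- s) tens p.1 p.2) = fsum_eval f s.
Proof. by rewrite linear_sum; apply: eq_bigr => p _; rewrite /= tliftE. Qed.

Lemma tensor_lin_ext (F : fieldType) (V W X : lmodType F)
    (g h : {linear tensor V W -> X}) :
  (forall v w, g (tens v w) = h (tens v w)) -> g =1 h.
Proof.
move=> gh t; have [s ->] := tensor_sum t; rewrite !linear_sum.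
by apply: eq_bigr => p _; exact: gh.
Qed.

(* f (x) g : v (x) w |-> f v (x) g w *)
Definition tmap_fun (F : fieldType) (V W V' W' : lmodType F)
  (f : {linear V -> V'}) (g : {linear W -> W'}) (v : V) (w : W) :
  tensor V' W' := tens (f v) (g w).

Lemma tmap_fun_is_bilinear (F : fieldType) (V W V' W' : lmodType F)
    (f : {linear V -> V'}) (g : {linear W -> W'}) :
  bilinear_for *:%R *:%R (tmap_fun f g).
Proof.
by split=> [w|v] a x y /=; rewrite /tmap_fun linearP /= ?linearPl ?linearPr.
Qed.

HB.instance Definition _ (F : fieldType) (V W V' W' : lmodType F)
    (f : {linear V -> V'}) (g : {linear W -> W'}) :=
  bilinear_isBilinear.Build F V W (tensor V' W') *:%R *:%R (tmap_fun f g)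
    (tmap_fun_is_bilinear f g).

Definition tmap (F : fieldType) (V W V' W' : lmodType F)
  (f : {linear V -> V'}) (g : {linear W -> W'}) :
  {linear tensor V W -> tensor V' W'} := tlift (tmap_fun f g).

(* T : v (x) w |-> w (x) v *)
Definition tswap_fun (F : fieldType) (V W : lmodType F) (v : V) (w : W) :
  tensor W V := tens w v.

Lemma tswap_fun_is_bilinear (F : fieldType) (V W : lmodType F) :
  bilinear_for *:%R *:%R (@tswap_fun F V W).
Proof.
by split=> [w|v] a x y /=; rewrite /tswap_fun ?linearPl ?linearPr.
Qed.

HB.instance Definition _ (F : fieldType) (V W : lmodType F) :=
  bilinear_isBilinear.Build F V W (tensor W V) *:%R *:%R (@tswap_fun F V W)
    (@tswap_fun_is_bilinear F V W).

Definition tswap (F : fieldType) (V W : lmodType F) :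
  {linear tensor V W -> tensor W V} := tlift (@tswap_fun F V W).

(* u (x) (v (x) w) |-> (u (x) v) (x) w *)
Definition tassoc_fun1 (F : fieldType) (U V W : lmodType F) (u : U) (v : V)
  (w : W) : tensor (tensor U V) W := tens (tens u v) w.

Lemma tassoc_fun1_is_bilinear (F : fieldType) (U V W : lmodType F) (u : U) :
  bilinear_for *:%R *:%R (@tassoc_fun1 F U V W u).
Proof.
by split=> [w|v] a x y /=; rewrite /tassoc_fun1 ?linearPr ?linearPl.
Qed.

HB.instance Definition _ (F : fieldType) (U V W : lmodType F) (u : U) :=
  bilinear_isBilinear.Build F V W (tensor (tensor U V) W) *:%R *:%R
    (@tassoc_fun1 F U V W u) (@tassoc_fun1_is_bilinear F U V W u).

Definition tassoc_fun (F : fieldType) (U V W : lmodType F) (u : U)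
  (t : tensor V W) : tensor (tensor U V) W := tlift (tassoc_fun1 u) t.

Lemma tassoc_fun_is_bilinear (F : fieldType) (U V W : lmodType F) :
  bilinear_for *:%R *:%R (@tassoc_fun F U V W).
Proof.
split=> [t|u] a x y /=; rewrite /tassoc_fun ?linearP //.
have [s ->] := tensor_sum t; rewrite !tlift_sum /fsum_eval.
rewrite scaler_sumr -big_split /=; apply: eq_bigr => p _.
by rewrite /tassoc_fun1 !linearPl.
Qed.

HB.instance Definition _ (F : fieldType) (U V W : lmodType F) :=
  bilinear_isBilinear.Build F U (tensor V W) (tensor (tensor U V) W)
    *:%R *:%R (@tassoc_fun F U V W) (@tassoc_fun_is_bilinear F U V W).

Definition tassoc (F : fieldType) (U V W : lmodType F) :
  {linear tensor U (tensor V W) -> tensor (tensor U V) W} :=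
  tlift (@tassoc_fun F U V W).

(* c (x) Id : V (x) W -> F (x) W = W  and  Id (x) c : V (x) W -> V (x) F = V *)
Definition contractl_fun (F : fieldType) (V W : lmodType F) (c : {scalar V})
  (v : V) (w : W) : W := c v *: w.

Lemma contractl_fun_is_bilinear (F : fieldType) (V W : lmodType F)
    (c : {scalar V}) : bilinear_for *:%R *:%R (@contractl_fun F V W c).
Proof.
split=> [w|v] a x y /=; rewrite /contractl_fun.
  by rewrite linearP /= scalerDl scalerA.
by rewrite scalerDr !scalerA mulrC.
Qed.

HB.instance Definition _ (F : fieldType) (V W : lmodType F) (c : {scalar V}) :=
  bilinear_isBilinear.Build F V W W *:%R *:%R (@contractl_fun F V W c)
    (@contractl_fun_is_bilinear F V W c).

Definition contractl (F : fieldType) (V W : lmodType F) (c : {scalar V}) :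
  {linear tensor V W -> W} := tlift (@contractl_fun F V W c).
Arguments contractl {F V W} c.

Definition contractr (F : fieldType) (V W : lmodType F) (c : {scalar W}) :
  tensor V W -> V := fun t => contractl c (tswap V W t).
Arguments contractr {F V W} c.

(* A formal series with coefficients in W is its coefficient function on the
   group M of exponents: M = int * int for the two variables x0, x2 and
   M = int * int * int for x0, x1, x2. *)

(* Product of a scalar series and a W-valued one. The sum is a junk 0 when it
   has infinitely many nonzero terms; by truncation this does not occur in the
   products below. *)
Definition smul (F : fieldType) (M : zmodType) (W : lmodType F)
  (f : M -> F) (g : M -> W) : M -> W :=
  fun m => \sum_(e \in [set: M]) f e *: g (m - e).

Definition gbinom (F : fieldType) (n : int) (r : nat) : F :=
  (\prod_(i < r) (n%:~R - i%:R)) / (r`!)%:R.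

(* (x^a + s x^b)^n, expanded in nonnegative powers of x^b, where x^a and x^b
   are two distinct variables, given by their exponents a and b *)
Definition binom_pow (F : fieldType) (M : zmodType) (a : M) (s : F) (b : M)
  (n : int) : M -> F :=
  fun m => \sum_(r \in [set: nat])
    (if m == a *~ (n - r%:Z) + b *+ r then gbinom F n r * s ^+ r else 0).

Definition exp3 : Type := (int * int * int)%type.
Definition X0 : exp3 := (1, 0, 0).
Definition X1 : exp3 := (0, 1, 0).
Definition X2 : exp3 := (0, 0, 1).

(* z^{-1} delta((a - b) / (s z)) = sum_n s^{-n} z^{-n-1} (a - b)^n *)
Definition delta3 (F : fieldType) (a b : exp3) (s : F) (z : exp3) : exp3 -> F :=
  fun m => \sum_(n \in [set: int])
    s ^ (- n) * binom_pow a (-1) b n (m - z *~ (- n - 1)).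

(* g(x0 + x2, x2), for g a series in two variables *)
Definition shift_first (F : fieldType) (W : lmodType F) (g : int * int -> W) :
  int * int -> W :=
  fun m => \sum_(e \in [set: int * int])
    binom_pow (1, 0) (1 : F) (0, 1) e.1 (m - (0, e.2)) *: g e.

Definition tensor3 (F : fieldType) (V : lmodType F) : lmodType F :=
  tensor (tensor V V) V.

(* In the next two definitions Y n is the coefficient of x^n in Y(x). *)

(* (Y(x) (x) Id) Y(y) v, as a series in (x, y) *)
Definition iterate_left (F : fieldType) (V : lmodType F)
  (Y : int -> {linear V -> tensor V V}) (v : V) : int * int -> tensor3 V :=
  fun e => tmap (Y e.1) idfun (Y e.2 v).

(* (Id (x) Y(y)) Y(x) v, as a series in (x, y) *)
Definition iterate_right (F : fieldType) (V : lmodType F)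
  (Y : int -> {linear V -> tensor V V}) (v : V) : int * int -> tensor3 V :=
  fun e => tassoc V V V (tmap idfun (Y e.2) (Y e.1 v)).

(* Series in two of the variables x0, x1, x2, seen as series in all three *)
Definition in02 (F : fieldType) (W : lmodType F) (g : int * int -> W) :
  exp3 -> W := fun '(a0, a1, a2) => if a1 == 0 then g (a0, a2) else 0.
Definition in12 (F : fieldType) (W : lmodType F) (g : int * int -> W) :
  exp3 -> W := fun '(a0, a1, a2) => if a0 == 0 then g (a1, a2) else 0.
Definition in21 (F : fieldType) (W : lmodType F) (g : int * int -> W) :
  exp3 -> W := fun '(a0, a1, a2) => if a0 == 0 then g (a2, a1) else 0.

Record vertex_coalgebra (F : fieldType) (V : lmodType F) := VertexCoalgebra {
  vcY : int -> {linear V -> tensor V V};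
  vcc : {scalar V};
  vc_counit : forall (v : V) (n : int),
    contractl vcc (vcY n v) = if n == 0 then v else 0;
  vc_cocreation : forall v : V,
    (forall n : int, n < 0 -> contractr vcc (vcY n v) = 0) /\
    contractr vcc (vcY 0 v) = v;
  vc_truncation : forall v : V,
    exists N : int, forall n : int, N < n -> vcY n v = 0;
  vc_jacobi : forall (v : V) (m : exp3),
    smul (delta3 X1 X2 (1 : F) X0) (in12 (iterate_right vcY v)) m
    - smul (delta3 X2 X1 (-1 : F) X0)
        (fun e => tmap (tswap V V) idfun (in21 (iterate_right vcY v) e)) m
    = smul (delta3 X1 X0 (1 : F) X2) (in02 (iterate_left vcY v)) m
}.

(* Delta_k: Y(x) v = sum_k Delta_k(v) x^{-k-1} *)
Definition vcDelta (F : fieldType) (V : lmodType F) (C : vertex_coalgebra V)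
  (k : int) : {linear V -> tensor V V} := vcY C (- k - 1).

Definition subspace (F : fieldType) (W : lmodType F) (A : set W) : Prop :=
  A 0 /\ forall (a : F) (u v : W), A u -> A v -> A (a *: u + v).

Definition is_grading (F : fieldType) (W : lmodType F) (G : int -> set W) :
  Prop :=
  (forall k, subspace (G k)) /\
  forall w : W, exists! f : int -> W,
    [/\ forall k, G k (f k), finite_set [set k | f k != 0]
      & w = \sum_(k \in [set: int]) f k].

(* Total weight: component n is the sum of the V_(i) (x) W_(j), i + j = n *)
Definition tensor_grading (F : fieldType) (V W : lmodType F)
  (G : int -> set V) (H : int -> set W) (n : int) : set (tensor V W) :=
  smallest (@subspace F (tensor V W))
    [set t | exists i j v w,
       [/\ i + j = n, G i v, H j w & t = tens v w]].

(* The sum of the Hom(W_(k), F), as the functionals on W whose restriction to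
   W_(k) is nonzero for only finitely many k; the pairing is evaluation. *)
Record graded_dual (F : fieldType) (W : lmodType F) (G : int -> set W) :=
  GradedDual {
    gd_fun :> {scalar W};
    gd_finite : finite_set [set k | exists2 w, G k w & gd_fun w != 0]
  }.

Lemma fsum_wide (I : choiceType) (U : zmodType) (A : set I) (f : I -> U) :
  finite_set A -> (forall k, f k != 0 -> A k) ->
  \sum_(k \in [set: I]) f k = \sum_(k <- fset_set A) f k.
Proof.
move=> fA sA; rewrite -(fsbig_widen A setT) //; first by rewrite fsbig_finite.
by move=> k [_ nAk] /=; apply/eqP; apply: contra_notT nAk => /sA.
Qed.

(* With the definition above, the graded dual is the sum of the
   Hom(W_(k), F): a finitely supported family of functionals phi_k on the
   W_(k) comes from exactly one element of it. *)
Lemma graded_dual_family (F : fieldType) (W : lmodType F) (G : int -> set W)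
    (phi : int -> W -> F) :
  is_grading G ->
  (forall k a u v, G k u -> G k v ->
     phi k (a *: u + v) = a * phi k u + phi k v) ->
  finite_set [set k | exists2 w, G k w & phi k w != 0] ->
  exists2 f : graded_dual G, (forall k w, G k w -> f w = phi k w) &
    forall g : graded_dual G, (forall k w, G k w -> g w = phi k w) -> g =1 f.
Proof.
move=> [subG decG] linphi; set S := [set k | _] => finS.
have /choice [d dP] := decG.
have phi0 k : phi k 0 = 0.
  have [G0 _] := subG k.
  have := linphi k (-1) 0 0 G0 G0.
  by rewrite scaler0 addr0 mulN1r addNr.
have notS k w : G k w -> ~ S k -> phi k w = 0.
  by move=> Gw; apply: contra_notP => /eqP; exists w.
pose f0 (w : W) : F := \sum_(k <- fset_set S) phi k (d w k).
have f0_lin : scalar f0.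
  move=> a u v; have [[Gu fu su] _] := dP u; have [[Gv fv sv] _] := dP v.
  have [[_ _ _] uniq_d] := dP (a *: u + v).
  have -> : f0 (a *: u + v)
            = \sum_(k <- fset_set S) phi k (a *: d u k + d v k).
    rewrite /f0 (uniq_d (fun k => a *: d u k + d v k)) //.
    set A := [set k | d u k != 0] `|` [set k | d v k != 0].
    have fA : finite_set A by rewrite finite_setU.
    have sA k : a *: d u k + d v k != 0 -> A k.
      apply: contra_neqP => /not_orP[/negP/negPn/eqP ->].
      by move=> /negP/negPn/eqP ->; rewrite scaler0 addr0.
    split.
    - by move=> k; have [_ ] := subG k; apply.
    - exact: sub_finite_set sA fA.
    - rewrite (fsum_wide fA sA) big_split -scaler_sumr {1}su {1}sv.
      by rewrite !(@fsum_wide _ _ A) // => k h; [right|left].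
  by rewrite /f0 mulr_sumr -big_split; apply: eq_bigr => k _; apply: linphi.
pose f : {scalar W} := HB.pack f0 (GRing.isLinear.Build F W F *%R f0 f0_lin).
have fE k w : G k w -> f w = phi k w.
  move=> Gw; have [_ uniq_d] := dP w.
  rewrite /= /f0 (uniq_d (fun j => if j == k then w else 0)); last first.
    have fk : finite_set [set k] by exact: finite_set1.
    have sk j : (if j == k then w else 0) != 0 -> [set k] j.
      by case: (j =P k) => [->//|_]; rewrite eqxx.
    split.
    - by move=> j; case: (j =P k) => [->//|_]; have [] := subG j.
    - exact: sub_finite_set sk fk.
    - by rewrite (fsum_wide fk sk) fset_set1 big_seq_fset1 eqxx.
  have [Sk|nSk] := pselect (S k).
    rewrite (big_fsetD1 k) ?in_fset_set ?inE //= eqxx big1_fset ?addr0 // => j.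
    by rewrite !inE => /andP[/negPf -> _] _; exact: phi0.
  rewrite (notS k w) // big1 // => j _; case: (j =P k) => [->|_]; last exact: phi0.
  exact: notS.
have ffin : finite_set [set k | exists2 w, G k w & f w != 0].
  by apply: sub_finite_set finS => k [w Gw]; rewrite (fE k w Gw); exists w.
exists (GradedDual ffin) => // g gE w.
have [[Gd fd sd] _] := dP w.
set A := [set k | d w k != 0] in fd *.
have e (h : graded_dual G) : h w = \sum_(k <- fset_set A) h (d w k).
  by rewrite {1}sd (fsum_wide fd) // linear_sum.
rewrite !e; apply: eq_bigr => k _.
by rewrite (gE k) // /= -fE.
Qed.

Record graded_vertex_coalgebra (F : fieldType) (V : lmodType F) :=
  GradedVertexCoalgebra {
    gvc_vc :> vertex_coalgebra V;
    gvc_gr : int -> set V;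
    gvc_grading : is_grading gvc_gr;
    gvc_bounded : exists N : int, forall k v, k < N -> gvc_gr k v -> v = 0;
    gvc_weight : forall (r k : int) (v : V), gvc_gr r v ->
      tensor_grading gvc_gr gvc_gr (r + k + 1) (vcDelta gvc_vc k v)
  }.

Definition tensor3_grading (F : fieldType) (V : lmodType F)
  (G : int -> set V) : int -> set (tensor3 V) :=
  tensor_grading (tensor_grading G G) G.

(* Main.v *)
Require Import Defs.
From mathcomp Require Import all_boot all_order all_algebra.
From mathcomp Require Import zify ring.
From mathcomp Require Import boolp classical_sets functions cardinality fsbigop.

Set Implicit Arguments.
Unset Strict Implicit.
Unset Printing Implicit Defensive.

Import Order.TTheory GRing.Theory Num.Theory.
Local Open Scope ring_scope.

(** Write J_L, J_R and J_S for the term of the Jacobi identity in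
    (Y(x0) (x) Id) Y(x2), the first one in (Id (x) Y(x2)) Y(x1), and the one
    with T, so that J_R - J_S = J_L. The delta functions force x1 = x0 + x2 in
    J_L and J_R, so multiplying D = J_L - J_R by x1 is the same as multiplying
    it by x0 + x2 (smul_delta_x1_rec, smul_delta_x2_rec), while the coefficient
    of x1^-1 in D is the difference of the two sides of coassociativity
    (smul_delta_x1_res, smul_delta_x2_res). Hence (x0 + x2)^k times that
    difference is the coefficient of x1^(-k-1) in D = - J_S
    (weak_coassociator_eq).

    The delta function of J_S contains only nonnegative powers of x1, so a
    coefficient of x1^(-k-1) involves only terms
    (T (x) Id) (Id (x) Y_n) Y_m v with n <= -k-1, where Y_n is the
    coefficient of x^n in Y(x). Since Y_n lowers the weight by n and the
    weights of V are at least some N, such a term has weights at least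
    2N + k + 1. The functional v' vanishes in weights above some M, so it
    kills J_S as soon as k >= M - 2N, whatever v is (dual_coproduct_swap,
    dual_swapped_jacobi_term). *)

(** * Sums supported on a sequence of exponents *)

Lemma fsum_along (I : choiceType) (U : zmodType) (f : I -> U) (h : nat -> I)
    (B : nat) :
  injective h -> (forall x, f x != 0 -> exists2 r, (r < B)%N & x = h r) ->
  \sum_(x \in [set: I]%classic) f x = \sum_(r < B) f (h r).
Proof.
move=> injh supp; rewrite -(@fsbig_widen _ _ _ _ (h @` `I_B)%classic) //.
  by rewrite fsbig_image -?fsbig_ord // => x y _ _ /injh.
move=> x [_ nx] /=; apply/eqP; apply: contra_notT nx => /supp[r rB ->].
by exists r.
Qed.

Lemma fsum_single (I : choiceType) (U : zmodType) (f : I -> U) (i : I) :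
  (forall x, x != i -> f x = 0) -> \sum_(x \in [set: I]%classic) f x = f i.
Proof.
move=> f0; rewrite -(@fsbig_widen _ _ _ _ [set i]%classic) ?fsbig_set1 //.
by move=> x [_ nx] /=; apply: f0; apply/eqP.
Qed.

Lemma smul_along (F : fieldType) (M : zmodType) (W : lmodType F) (f : M -> F)
    (g : M -> W) (m : M) (h : nat -> M) (B : nat) :
  injective h ->
  (forall e, f e != 0 -> g (m - e) != 0 -> exists2 r, (r < B)%N & e = h r) ->
  smul f g m = \sum_(r < B) f (h r) *: g (m - h r).
Proof.
move=> injh supp; rewrite /smul; apply: fsum_along => // e.
by rewrite scaler_eq0 negb_or => /andP[]; apply: supp.
Qed.

(** * Exponents *)

Lemma prodZ (U V : zmodType) (u : U) (v : V) (n : int) :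
  ((u, v) : U * V) *~ n = (u *~ n, v *~ n).
Proof.
apply: (@etrans _ _ ((((u, v) : U * V) *~ n).1, (((u, v) : U * V) *~ n).2)).
  by case: (_ *~ n).
by rewrite (raddfMz fst) (raddfMz snd).
Qed.

Lemma prodMn (U V : zmodType) (u : U) (v : V) (n : nat) :
  ((u, v) : U * V) *+ n = (u *+ n, v *+ n).
Proof. exact: (prodZ u v n%:Z). Qed.

Lemma prodD (U V : zmodType) (u u' : U) (v v' : V) :
  ((u, v) : U * V) + (u', v') = (u + u', v + v').
Proof. by []. Qed.

Lemma prodN (U V : zmodType) (u : U) (v : V) :
  - ((u, v) : U * V) = (- u, - v).
Proof. by []. Qed.

Definition prodE := (prodZ, prodMn, prodD, prodN,
  mul0rz, mul0rn, intz, natz, addr0, add0r).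

(** * Coefficients of the binomial and delta series *)

Section Binom.
Variables (F : fieldType).

Lemma binom_pow_supp (M : zmodType) (a b : M) (s : F) (n : int) (m : M) :
  binom_pow a s b n m != 0 -> exists r : nat, m = a *~ (n - r%:Z) + b *+ r.
Proof.
apply: contra_neqP => /forallNP h; rewrite /binom_pow fsbig1 // => r _.
by case: eqP => // /h.
Qed.

Lemma binom_powE (M : zmodType) (a b : M) (s : F) (n : int) (r : nat) :
  injective (fun j : nat => a *~ (n - j%:Z) + b *+ j) ->
  binom_pow a s b n (a *~ (n - r%:Z) + b *+ r) = gbinom F n r * s ^+ r.
Proof.
move=> inj; rewrite /binom_pow (@fsum_single _ _ _ r) ?eqxx // => j njr.
by case: eqP => // /inj /esym /eqP; rewrite (negPf njr).
Qed.

(** The exponent of the monomial z^(-n-1) a^(n-r) b^r of the delta series. *)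
Definition delta_exponent (a b z : exp3) (n : int) (r : nat) : exp3 :=
  z *~ (- n - 1) + (a *~ (n - r%:Z) + b *+ r).

Lemma delta3_supp (a b z : exp3) (s : F) (m : exp3) :
  delta3 a b s z m != 0 -> exists n r, m = delta_exponent a b z n r.
Proof.
apply: contra_neqP => /forallNP h; rewrite /delta3 fsbig1 // => n _.
apply/eqP; rewrite mulf_eq0; apply/orP; right; apply: contra_notT (h n).
by move=> /binom_pow_supp [r e]; exists r; rewrite /delta_exponent -e addrC subrK.
Qed.

Lemma delta3E (a b z : exp3) (s : F) (n : int) (r : nat) :
  injective (fun p : int * nat => delta_exponent a b z p.1 p.2) ->
  delta3 a b s z (delta_exponent a b z n r) = s ^ (- n) * (gbinom F n r * (-1) ^+ r).
Proof.
move=> inj; rewrite /delta3 (@fsum_single _ _ _ n) => [|j njn].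
  rewrite /delta_exponent [_ + _ - _]addrAC subrr add0r binom_powE // => i j e.
  by apply: (congr1 snd (inj (n, i) (n, j) _)); rewrite /delta_exponent /= e.
apply/eqP; rewrite mulf_eq0; apply/orP; right; apply: contra_neqT njn.
move=> /binom_pow_supp[r' e].
suff /inj [-> //] : delta_exponent a b z (j, r').1 (j, r').2
                    = delta_exponent a b z (n, r).1 (n, r).2.
by rewrite {1}/delta_exponent /= -e addrC subrK.
Qed.

Lemma smul_delta3 (W : lmodType F) (a b z : exp3) (s : F) (g : exp3 -> W)
    (m : exp3) (n : nat -> int) (B : nat) :
  injective (fun p : int * nat => delta_exponent a b z p.1 p.2) ->
  (forall n' r, g (m - delta_exponent a b z n' r) != 0 -> n' = n r /\ (r < B)%N) ->
  smul (delta3 a b s z) g m =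
  \sum_(r < B) (s ^ (- n r) * (gbinom F (n r) r * (-1) ^+ r))
                 *: g (m - delta_exponent a b z (n r) r).
Proof.
move=> inj supp.
rewrite (@smul_along _ _ _ _ _ _ (fun r => delta_exponent a b z (n r) r) B).
- by apply: eq_bigr => r _; rewrite delta3E.
- by move=> i j e; apply: (congr1 snd (inj (n i, i) (n j, j) e)).
move=> e /delta3_supp[n' [r ->]] /supp[-> rB].
by exists r.
Qed.

End Binom.

(** * Generalized binomial coefficients *)

Section Gbinom.
Variable (F : fieldType).

Lemma gbinom0 (n : int) : gbinom F n 0 = 1.
Proof. by rewrite /gbinom big_ord0 fact0 divr1. Qed.

Lemma gbinom_pascal (charF : [pchar F] =i pred0) (n : int) (r : nat) :
  gbinom F (n + 1) r.+1 = gbinom F n r.+1 + gbinom F n r.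
Proof.
have nat0 (i : nat) : (i.+1)%:R != 0 :> F by have /pcharf0P -> := charF.
have fact0 (i : nat) : (i`!)%:R != 0 :> F.
  by case: i`! (fact_gt0 i) => // i' _; apply: nat0.
rewrite /gbinom big_ord_recl big_ord_recr /= factS natrM.
under eq_bigr => i _ do
  rewrite /bump /= add1n -(natr1 i) intrD opprD addrACA subrr addr0.
set P := \prod_(i < r) _; rewrite intrD -natr1.
have := nat0 r; rewrite -natr1.
by move=> *; field; rewrite fact0.
Qed.

Lemma gbinom_small (n r : nat) : (n < r)%N -> gbinom F n%:Z r = 0.
Proof.
by move=> nr; rewrite /gbinom (bigD1 (Ordinal nr)) //= subrr !mul0r.
Qed.

(** Upper negation: with the sign absorbed, both numerators are the product of
    n + 1, ..., n + r, the right-hand one in decreasing order. *)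
Lemma gbinom_neg (n : int) (r : nat) :
  gbinom F (- n - 1) r * (-1) ^+ r = gbinom F (n + r%:Z) r.
Proof.
rewrite /gbinom mulrAC; congr (_ / _).
rewrite -[X in (-1) ^+ X](card_ord r) -prodr_const -big_split /=.
rewrite (reindex_inj rev_ord_inj); apply: eq_bigr => i _ /=.
rewrite natrB // !intrD -natr1 mulrNz; ring.
Qed.

(** The shape in which Pascal's rule enters every recurrence below: it splits a
    series into two, one of them shifted by one step. *)
Lemma pascal_sum (W : lmodType F) (c c' c'' : nat -> F) (u : nat -> W) (B : nat) :
  c 0%N = c' 0%N -> (forall r, c r.+1 = c' r.+1 + c'' r) ->
  \sum_(r < B.+1) c r *: u r =
  \sum_(r < B.+1) c' r *: u r + \sum_(r < B) c'' r *: u r.+1.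
Proof.
move=> c0 cS; rewrite !big_ord_recl /= c0 -addrA -big_split /=; congr (_ + _).
by apply: eq_bigr => r _; rewrite /bump /= add1n cS scalerDl.
Qed.
End Gbinom.

(** * Closed forms of the series products *)

Section Series.
Variables (F : fieldType) (W : lmodType F).

Definition first_bounded (N : int) (g : int * int -> W) :=
  forall i j, N < i -> g (i, j) = 0.
Definition second_bounded (N : int) (g : int * int -> W) :=
  forall i j, N < j -> g (i, j) = 0.

(** The power of x0 fixes the index n = - m0 - 1 of the delta function, and the
    truncation of g bounds the remaining sum. Any sufficiently large bound B is
    allowed, so that sums for neighbouring exponents can be given a common one. *)
Lemma smul_delta_x1E (N : int) (g : int * int -> W) (m0 m1 m2 : int) (B : nat) :
  first_bounded N g -> N <= m0 + m1 + B%:Z ->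
  smul (delta3 X1 X2 (1 : F) X0) (in12 g) (m0, m1, m2) =
  \sum_(r < B) (gbinom F (- m0 - 1) r * (-1) ^+ r)
                 *: g (m0 + m1 + 1 + r%:Z, m2 - r%:Z).
Proof.
move=> gN NB; rewrite (@smul_delta3 _ _ _ _ _ _ _ _ (fun=> - m0 - 1) B).
- apply: eq_bigr => r _; rewrite exp1rz mul1r; congr (_ *: _).
  rewrite /delta_exponent /X0 /X1 /X2 !prodE /=.
  case: eqP => [_|]; last by lia.
  by congr (g (_, _)); lia.
- move=> [n r] [n' r']; rewrite /delta_exponent /X0 /X1 /X2 !prodE /=.
  by move=> -[? _ ?]; congr (_, _); lia.
move=> n r; rewrite /delta_exponent /X0 /X1 /X2 !prodE /=.
case: (m0 - (- n - 1) =P 0) => [e|_]; last by rewrite eqxx.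
have [] := ltP N (m1 + - (n + - r%:Z)) => [/gN -> | le _]; first by rewrite eqxx.
by split; lia.
Qed.

(** Here it is the power of x1 that ties the index of the delta function to r,
    through n = m1 + r. *)
Lemma smul_delta_x2E (N : int) (g : int * int -> W) (m0 m1 m2 : int) (B : nat) :
  second_bounded N g -> N <= m1 + m2 + B%:Z ->
  smul (delta3 X1 X0 (1 : F) X2) (in02 g) (m0, m1, m2) =
  \sum_(r < B) (gbinom F (m1 + r%:Z) r * (-1) ^+ r)
                 *: g (m0 - r%:Z, m1 + m2 + 1 + r%:Z).
Proof.
move=> gN NB; rewrite (@smul_delta3 _ _ _ _ _ _ _ _ (fun r => m1 + r%:Z) B).
- apply: eq_bigr => r _; rewrite exp1rz mul1r; congr (_ *: _).
  rewrite /delta_exponent /X0 /X1 /X2 !prodE /=.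
  case: eqP => [_|]; last by lia.
  by congr (g (_, _)); lia.
- move=> [n r] [n' r']; rewrite /delta_exponent /X0 /X1 /X2 !prodE /=.
  by move=> -[? ? ?]; congr (_, _); lia.
move=> n r; rewrite /delta_exponent /X0 /X1 /X2 !prodE /=.
case: (m1 - (n - r%:Z) =P 0) => [e|_]; last by rewrite eqxx.
have [] := ltP N (m2 + - (- n - 1)) => [/gN -> | le _]; first by rewrite eqxx.
by split; lia.
Qed.

Lemma binom_pow_xyE (n : int) (r : nat) :
  binom_pow (1, 0) (1 : F) (0, 1) n (n - r%:Z, r%:Z) = gbinom F n r.
Proof.
pose h (j : nat) : int * int := (1, 0) *~ (n - j%:Z) + (0, 1) *+ j.
have hE j : h j = (n - j%:Z, j%:Z) by rewrite /h !prodE.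
by rewrite -hE binom_powE ?expr1n ?mulr1 // => i j; rewrite -!/(h _) !hE => -[_]; lia.
Qed.

Lemma smul_binom_powE (g : int * int -> W) (k : nat) (m0 m2 : int) :
  smul (binom_pow (1, 0) (1 : F) (0, 1) k%:Z) g (m0, m2) =
  \sum_(r < k.+1) gbinom F k%:Z r *: g (m0 - k%:Z + r%:Z, m2 - r%:Z).
Proof.
rewrite (@smul_along _ _ _ _ _ _ (fun r => (k%:Z - r%:Z, r%:Z)) k.+1).
- apply: eq_bigr => r _; rewrite binom_pow_xyE; congr (_ *: g _).
  by rewrite !prodE /=; congr (_, _); lia.
- by move=> i j [_]; lia.
move=> e + _ => ne0; have [r er] := binom_pow_supp ne0.
move: er ne0; rewrite !prodE => -> ne0.
exists r => //; rewrite ltnS leqNgt; apply: contraNN ne0 => kr.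
by rewrite binom_pow_xyE gbinom_small.
Qed.

Lemma shift_firstE (N : int) (g : int * int -> W) (m0 m2 : int) (B : nat) :
  first_bounded N g -> N < m0 + B%:Z ->
  shift_first g (m0, m2) =
  \sum_(r < B) gbinom F (m0 + r%:Z) r *: g (m0 + r%:Z, m2 - r%:Z).
Proof.
move=> gN NB; rewrite /shift_first.
rewrite (@fsum_along _ _ _ (fun r => (m0 + r%:Z, m2 - r%:Z)) B).
- apply: eq_bigr => r _; rewrite -binom_pow_xyE /=; congr (binom_pow _ _ _ _ _ *: _).
  by rewrite !prodE /=; congr (_, _); lia.
- by move=> i j [_]; lia.
move=> [e0 e2]; rewrite scaler_eq0 negb_or /= => /andP[/binom_pow_supp[r]].
rewrite !prodE => -[h0 h2] gn0; exists r; last by congr (_, _); lia.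
rewrite ltnNge; apply: contraNN gn0 => Br; rewrite gN //; lia.
Qed.
End Series.

(** * Multiplication by x1 and by x0 + x2 *)

Section Recurrences.
Variables (F : fieldType) (charF : [pchar F] =i pred0) (W : lmodType F).

Let bigB (N m : int) : exists B : nat, N <= m + B%:Z.
Proof. by exists `|N - m|%N; lia. Qed.

(** x1 J = (x0 + x2) J, because the delta function is x1^-1 delta((x0+x2)/x1). *)
Lemma smul_delta_x1_rec (N : int) (g : int * int -> W) (m0 m1 m2 : int) :
  first_bounded N g ->
  let J := smul (delta3 X1 X2 (1 : F) X0) (in12 g) in
  J (m0, m1 - 1, m2) = J (m0 - 1, m1, m2) + J (m0, m1, m2 - 1).
Proof.
move=> gN J; have [B NB] := bigB N (m0 + m1 - 1).
rewrite /J (@smul_delta_x1E _ _ N _ _ _ _ B.+1) //; last by lia.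
rewrite (@smul_delta_x1E _ _ N _ (m0 - 1) _ _ B.+1) //; last by lia.
rewrite (@smul_delta_x1E _ _ N _ m0 m1 (m2 - 1) B) //; last by lia.
pose c (n : int) (r : nat) : F := gbinom F n r * (-1) ^+ r.
apply: etrans (@pascal_sum _ _ (c (- m0 - 1)) (c (- (m0 - 1) - 1)) (c (- m0 - 1))
  (fun r => g (m0 + (m1 - 1) + 1 + r%:Z, m2 - r%:Z)) B _ _) _; rewrite /c.
- by rewrite !gbinom0.
- move=> r; have -> : - (m0 - 1) - 1 = - m0 - 1 + 1 by lia.
  by rewrite gbinom_pascal // exprS; ring.
by congr (_ + _); apply: eq_bigr => r _; congr (_ *: g (_, _)); lia.
Qed.

(** x1 J = (x0 + x2) J, because the delta function is x1^-1 delta((x2+x0)/x1). *)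
Lemma smul_delta_x2_rec (N : int) (g : int * int -> W) (m0 m1 m2 : int) :
  second_bounded N g ->
  let J := smul (delta3 X1 X0 (1 : F) X2) (in02 g) in
  J (m0, m1 - 1, m2) = J (m0 - 1, m1, m2) + J (m0, m1, m2 - 1).
Proof.
move=> gN J; have [B NB] := bigB N (m1 + m2 - 1).
rewrite /J [RHS]addrC (@smul_delta_x2E _ _ N _ m0 _ _ B.+1) //; last by lia.
rewrite (@smul_delta_x2E _ _ N _ m0 m1 (m2 - 1) B.+1) //; last by lia.
rewrite (@smul_delta_x2E _ _ N _ (m0 - 1) m1 m2 B) //; last by lia.
pose c (n : int) (r : nat) : F := gbinom F (n + r%:Z) r * (-1) ^+ r.
apply: etrans (@pascal_sum _ _ (c (m1 - 1)) (c m1) (c m1)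
  (fun r => g (m0 - r%:Z, m1 - 1 + m2 + 1 + r%:Z)) B _ _) _; rewrite /c.
- by rewrite !gbinom0.
- move=> r; have -> : m1 - 1 + r.+1%:Z = m1 + r%:Z by lia.
  have -> : m1 + r.+1%:Z = m1 + r%:Z + 1 by lia.
  by rewrite gbinom_pascal // exprS; ring.
by congr (_ + _); apply: eq_bigr => r _; congr (_ *: g (_, _)); lia.
Qed.

Lemma smul_binom_pow_rec (g : int * int -> W) (k : nat) (m0 m2 : int) :
  let P k := smul (binom_pow (1, 0) (1 : F) (0, 1) k%:Z) g in
  P k.+1 (m0, m2) = P k (m0 - 1, m2) + P k (m0, m2 - 1).
Proof.
move=> P; rewrite /P !smul_binom_powE.
apply: etrans (@pascal_sum _ _ (gbinom F k.+1) (gbinom F k) (gbinom F k)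
  (fun r => g (m0 - k.+1%:Z + r%:Z, m2 - r%:Z)) k.+1 _ _) _.
- by rewrite !gbinom0.
- by move=> r; rewrite -gbinom_pascal //; congr (gbinom _ _ _); lia.
congr (_ + _).
  rewrite big_ord_recr /= gbinom_small // scale0r addr0.
  by apply: eq_bigr => r _; congr (_ *: g (_, _)); lia.
by apply: eq_bigr => r _; congr (_ *: g (_, _)); lia.
Qed.

Lemma smul_binom_pow0 (g : int * int -> W) (m : int * int) :
  smul (binom_pow (1, 0) (1 : F) (0, 1) 0%:Z) g m = g m.
Proof.
case: m => m0 m2; rewrite smul_binom_powE big_ord1 gbinom0 scale1r.
by congr (g (_, _)) => /=; lia.
Qed.

(** The delta function replaces x1 by x0 + x2. The coefficients agree by upper
    negation: one side expands (x1 - x2)^n at n = - m0 - 1, the other expands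
    (x0 + x2)^(m0 + r). *)
Lemma smul_delta_x1_res (N : int) (g : int * int -> W) (m0 m2 : int) :
  first_bounded N g ->
  smul (delta3 X1 X2 (1 : F) X0) (in12 g) (m0, -1, m2) = shift_first g (m0, m2).
Proof.
move=> gN; have [B NB] := bigB (N + 1) m0.
rewrite (@smul_delta_x1E _ _ N _ _ _ _ B) //; last by lia.
rewrite (@shift_firstE _ _ N _ _ _ B) //; last by lia.
apply: eq_bigr => r _; rewrite gbinom_neg.
by congr (_ *: g (_, _)); lia.
Qed.

(** Only r = 0 contributes, since the binomial coefficients of r - 1 over r
    vanish for r > 0. *)
Lemma smul_delta_x2_res (N : int) (g : int * int -> W) (m0 m2 : int) :
  second_bounded N g ->
  smul (delta3 X1 X0 (1 : F) X2) (in02 g) (m0, -1, m2) = g (m0, m2).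
Proof.
move=> gN; have [B NB] := bigB N (m2 - 1).
rewrite (@smul_delta_x2E _ _ N _ _ _ _ B.+1) //; last by lia.
rewrite big_ord_recl big1 ?addr0 /= => [|r _].
  by rewrite gbinom0 mul1r scale1r; congr (g (_, _)); lia.
have -> : (-1 + (bump 0 r)%:Z) = r%:Z by rewrite /bump /= add1n; lia.
by rewrite gbinom_small ?mul0r ?scale0r // /bump /= add1n.
Qed.

(** If multiplication by x1 and by x0 + x2 agree on D, then (x0 + x2)^k times
    the residue of D at x1 is the residue of x1^k D. *)
Lemma smul_binom_pow_iter (D : exp3 -> W) (h : int * int -> W) :
  (forall m0 m1 m2,
     D (m0, m1 - 1, m2) = D (m0 - 1, m1, m2) + D (m0, m1, m2 - 1)) ->
  (forall m0 m2, D (m0, -1, m2) = h (m0, m2)) ->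
  forall (k : nat) m0 m2,
    smul (binom_pow (1, 0) (1 : F) (0, 1) k%:Z) h (m0, m2) =
    D (m0, - k%:Z - 1, m2).
Proof.
move=> Drec Dres; elim=> [|k IH] m0 m2.
  by rewrite smul_binom_pow0 -Dres.
rewrite smul_binom_pow_rec !IH -Drec.
by congr (D (_, _, _)); lia.
Qed.
End Recurrences.

(** * Subspaces, gradings and graded duals *)

Section Subspaces.
Variables (F : fieldType).

Lemma subspace_fsum (W : lmodType F) (A : set W) (I : choiceType) (f : I -> W) :
  subspace A -> (forall i, A (f i)) -> A (\sum_(i \in [set: I]%classic) f i).
Proof.
move=> [A0 AP] Af; elim/big_ind: _ => // u v Au Av.
by rewrite -[u]scale1r; apply: AP.
Qed.

Lemma subspace_tensor_grading (V W : lmodType F) (G : int -> set V)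
    (H : int -> set W) (n : int) (A : set (tensor V W)) :
  subspace A ->
  (forall i j v w, i + j = n -> G i v -> H j w -> A (tens v w)) ->
  forall t, tensor_grading G H n t -> A t.
Proof.
move=> sA AG; apply: smallest_sub => // _ [i [j [v [w [ijn Gv Hw ->]]]]].
exact: AG Gv Hw.
Qed.

Lemma subspace_tensor (V W : lmodType F) (A : set (tensor V W)) :
  subspace A -> (forall v w, A (tens v w)) -> forall t, A t.
Proof.
move=> [A0 AP] At t; have [s ->] := tensor_sum t.
by elim/big_ind: _ => // u v Au Av; rewrite -[u]scale1r; apply: AP.
Qed.

Lemma tens_grading (V W : lmodType F) (G : int -> set V) (H : int -> set W)
    (i j : int) (v : V) (w : W) :
  G i v -> H j w -> tensor_grading G H (i + j) (tens v w).
Proof. by move=> Gv Hw; apply: sub_gen_smallest; exists i, j, v, w. Qed.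

Lemma subspace_grading (W : lmodType F) (G : int -> set W) (A : set W) :
  is_grading G -> subspace A -> (forall k w, G k w -> A w) -> forall w, A w.
Proof.
move=> [_ decG] sA AG w; have [f [[Gf _ ->] _]] := decG w.
by apply: subspace_fsum => // k; apply: AG (Gf k).
Qed.

Lemma graded_dual_bound (W : lmodType F) (G : int -> set W) (f : graded_dual G) :
  exists M : int, forall k w, M < k -> G k w -> f w = 0.
Proof.
have /finite_seqP[s sE] := gd_finite f.
have [M sM] : exists M : int, forall k, k \in s -> k <= M.
  elim: s {sE} => [|a s [M sM]]; first by exists 0.
  exists (Num.max a M) => k; rewrite inE le_max => /orP[/eqP-> | /sM ->].
    by rewrite lexx.
  by rewrite orbT.
exists M => k w Mk Gw; apply/eqP; apply: contraTT Mk => fw.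
rewrite -leNgt; apply: sM.
by have : [set` s]%classic k by rewrite -sE; exists w.
Qed.

End Subspaces.

(** * Structure maps on pure tensors *)

Section TensorMaps.
Variables (F : fieldType).

Lemma tmap_tens (V W V' W' : lmodType F) (f : {linear V -> V'})
    (g : {linear W -> W'}) (v : V) (w : W) :
  tmap f g (tens v w) = tens (f v) (g w).
Proof. exact: (tliftE (tmap_fun f g)). Qed.

Lemma tswap_tens (V W : lmodType F) (v : V) (w : W) :
  tswap V W (tens v w) = tens w v.
Proof. exact: (tliftE (@tswap_fun F V W)). Qed.

Lemma tassoc_tens (U V W : lmodType F) (u : U) (v : V) (w : W) :
  tassoc U V W (tens u (tens v w)) = tens (tens u v) w.
Proof.
exact: etrans (tliftE (@tassoc_fun F U V W) _ _) (tliftE (tassoc_fun1 u) _ _).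
Qed.

End TensorMaps.

(** * Weights and the Jacobi identity *)

Section Coalgebra.
Variables (F : fieldType) (V : lmodType F).

Definition coproduct_swap (Y : int -> {linear V -> tensor V V}) (n : int)
  : {linear tensor V V -> tensor3 V} :=
  tmap (tswap V V) idfun \o (tassoc V V V \o tmap idfun (Y n)).

(** Indexing by powers of x instead of by Delta_k: the coefficient of x^n lowers
    the weight by n. *)
Lemma gvc_weightY (C : graded_vertex_coalgebra V) (r n : int) (w : V) :
  gvc_gr C r w -> tensor_grading (gvc_gr C) (gvc_gr C) (r - n) (vcY C n w).
Proof.
move=> Gw; have := @gvc_weight _ _ C r (- n - 1) w Gw.
rewrite /vcDelta; have -> : r + (- n - 1) + 1 = r - n by lia.
by have -> : - (- n - 1) - 1 = n by lia.
Qed.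

(** By linearity t may be taken to be u (x) w with u and w homogeneous, of
    weights at least N; then the argument of v' has weight
    wt u + wt w - n >= 2N - n > M. *)
Lemma dual_coproduct_swap (C : graded_vertex_coalgebra V)
    (v' : {scalar tensor3 V}) (M N : int) :
  (forall k w, M < k -> tensor3_grading (gvc_gr C) k w -> v' w = 0) ->
  (forall k w, k < N -> gvc_gr C k w -> w = 0) ->
  forall n t, M < N + N - n -> v' (coproduct_swap (vcY C) n t) = 0.
Proof.
move=> v'M GN n t MN; have gr := gvc_grading C.
move: t; apply: subspace_tensor => [|u w].
  split=> [|a x y ex ey]; first by rewrite !linear0.
  by rewrite !linearP ex ey mulr0 addr0.
rewrite /= tmap_tens /=.
move: w; apply: (subspace_grading gr) => [|j w Gw].
  split=> [|a x y ex ey]; first by rewrite linear0 linear0r !linear0.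
  by rewrite !(linearP, linearPr) /= ex ey mulr0 addr0.
move: u; apply: (subspace_grading gr) => [|i u Gu].
  split=> [|a x y ex ey]; first by rewrite linear0l !linear0.
  by rewrite linearPl !linearP /= ex ey mulr0 addr0.
have [iN|Ni] := ltP i N; first by rewrite (GN i u iN Gu) linear0l !linear0.
have [jN|Nj] := ltP j N.
  by rewrite (GN j w jN Gw) linear0 linear0r !linear0.
move: (@gvc_weightY C j n w Gw); move: (vcY C n w); apply: subspace_tensor_grading.
  split=> [|a x y ex ey]; first by rewrite linear0r !linear0.
  by rewrite linearPr !linearP /= ex ey mulr0 addr0.
move=> p q a b pq Ga Gb.
rewrite tassoc_tens tmap_tens tswap_tens /=.
apply: (v'M (p + i + q)); first by lia.
by apply: tens_grading Gb; apply: tens_grading.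
Qed.

(** The expansion of (x2 - x1)^n only raises the power of x1, so the coefficient
    of x1^m1 sees only the coefficients of Y at powers n <= m1. *)
Lemma dual_swapped_jacobi_term (Y : int -> {linear V -> tensor V V}) (v : V)
    (v' : {scalar tensor3 V}) (m0 m1 m2 : int) :
  (forall n t, n <= m1 -> v' (coproduct_swap Y n t) = 0) ->
  v' (smul (delta3 X2 X1 (-1 : F) X0)
        (fun e => tmap (tswap V V) idfun (in21 (iterate_right Y v) e))
        (m0, m1, m2)) = 0.
Proof.
move=> v'0; apply: (@subspace_fsum _ _ [set w | v' w = 0]%classic) => [|e /=].
  by split=> [|a x y /= ex ey]; rewrite /= ?linear0 // linearP ex ey mulr0 addr0.
have [->|/delta3_supp[n [r ->]]] := eqVneq (delta3 X2 X1 (-1 : F) X0 e) 0.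
  by rewrite scale0r linear0.
rewrite linearZ /delta_exponent /X0 /X1 /X2 !prodE /=.
case: ifP => _; last by rewrite !linear0 mulr0.
by rewrite v'0 ?mulr0 //=; lia.
Qed.

(** Coassociativity fails by the term of the Jacobi identity with T: that term is
    minus the difference D of the two others, and D satisfies the hypotheses of
    smul_binom_pow_iter. *)
Lemma weak_coassociator_eq (charF : [pchar F] =i pred0) (C : vertex_coalgebra V)
    (v' : {scalar tensor3 V}) (v : V) (k : nat) (m0 m2 : int) :
  smul (binom_pow (1, 0) (1 : F) (0, 1) k%:Z)
    (fun e : int * int =>
       v' (iterate_left (vcY C) v e
           - shift_first (iterate_right (vcY C) v) e) : F^o) (m0, m2) =
  - v' (smul (delta3 X2 X1 (-1 : F) X0)
        (fun e => tmap (tswap V V) idfun (in21 (iterate_right (vcY C) v) e))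
        (m0, - k%:Z - 1, m2)).
Proof.
have [N vN] := vc_truncation C v.
have lN : second_bounded N (iterate_left (vcY C) v).
  by move=> i j Nj; rewrite /iterate_left /= vN // linear0.
have rN : first_bounded N (iterate_right (vcY C) v).
  by move=> i j Nj; rewrite /iterate_right /= vN // !linear0.
pose JL := smul (delta3 X1 X0 (1 : F) X2) (in02 (iterate_left (vcY C) v)).
pose JR := smul (delta3 X1 X2 (1 : F) X0) (in12 (iterate_right (vcY C) v)).
have recL : forall i0 i1 i2,
    JL (i0, i1 - 1, i2) = JL (i0 - 1, i1, i2) + JL (i0, i1, i2 - 1).
  by move=> *; apply: smul_delta_x2_rec lN.
have recR : forall i0 i1 i2,
    JR (i0, i1 - 1, i2) = JR (i0 - 1, i1, i2) + JR (i0, i1, i2 - 1).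
  by move=> *; apply: smul_delta_x1_rec rN.
have resL : forall i0 i2, JL (i0, -1, i2) = iterate_left (vcY C) v (i0, i2).
  by move=> *; apply: smul_delta_x2_res lN.
have resR : forall i0 i2,
    JR (i0, -1, i2) = shift_first (iterate_right (vcY C) v) (i0, i2).
  by move=> *; apply: smul_delta_x1_res rN.
have : JR (m0, - k%:Z - 1, m2) - _ = JL (m0, - k%:Z - 1, m2) := vc_jacobi C v _.
move: (smul (delta3 X2 X1 _ X0) _ _) => JB jacobi.
clearbody JL JR.
rewrite (@smul_binom_pow_iter _ charF _ (fun m => v' (JL m - JR m) : F^o)).
- by rewrite -jacobi addrAC subrr sub0r linearN.
- by move=> i0 i1 i2; rewrite recL recR opprD addrACA; apply: (linearD v').
- by move=> i0 i2; rewrite resL resR.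
Qed.

End Coalgebra.

Theorem proposition2p9 (F : fieldType) (charF : [pchar F] =i pred0)
    (V : lmodType F) (C : graded_vertex_coalgebra V)
    (v' : graded_dual (tensor3_grading (gvc_gr C))) :
  exists k : nat, (0 < k)%N /\
    forall (v : V) (m : int * int),
      smul (binom_pow (1, 0) (1 : F) (0, 1) k%:Z)
        (fun e : int * int =>
           v' (iterate_left (vcY C) v e
               - shift_first (iterate_right (vcY C) v) e) : F^o) m = 0.
Proof.
have [M v'M] := graded_dual_bound v'.
have [N GN] := gvc_bounded C.
(* For n <= - k - 1 this k gives 2N - n >= 2N + k + 1 > M; the successor
   makes k positive. *)
exists `|(M - N - N)%R|%N.+1; split=> // v [m0 m2].
rewrite weak_coassociator_eq // dual_swapped_jacobi_term ?oppr0 // => n t nk.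
by apply: dual_coproduct_swap v'M GN _ _ _; lia.
Qed.
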